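(* Let $(\Psi_u,\Psi_l,\mathcal{S},\mathcal{T},\epsilon)$ be a solution of the SOS program (P) (given in the context), $V_u=-\lambda\log\Psi_l$, and consider the controller $u^\epsilon=-R^{-1}G^T\nabla_xV_u$. If $$\mathrm{Tr}\left((\nabla_{xx}V_u)\Sigma_t\right)\ge0\quad\forall x\in\Omega\setminus\{0\},$$ then $u^\epsilon$ is a stabilizing controller for the deterministic system $dx_t=(f(x_t)+G(x_t)u_t)\,dt$. If $$\mathrm{Tr}\left((\nabla_{xx}V_u)\Sigma_t\right)>0\quad\forall x\in\Omega\setminus\{0\},$$ then $u^\epsilon$ is an asymptotically stabilizing controller for this system.
   Context: Deterministic problem. System $dx_t=(f(x_t)+G(x_t)u_t)\,dt$ with cost $J(x,u)=\phi(x_T)+\int_0^Tq(x_t)+\frac12u_t^TRu_t\,dt$, $T$ the first time the boundary or the origin is reached. Here $\Omega=\{x\in\mathbb{R}^n: g_i(x)\ge 0,\ i=1,\dots,k\}$, $g_i\in\mathbb{R}[x]$, is a compact basic closed semialgebraic set, $0\in\Omega$, $\partial\Omega=\{x:\prod_{i=1}^m h_i(x)=0\}$, $h_i\in\mathbb{R}[x]$; $f,G$ have real polynomial entries, $f(0)=0$, $G(0)=0$; $R$ is symmetric positive definite; $\phi,q$ are nonnegative polynomials, positive definite on $\Omega$ (zero at $0$, positive on $\Omega\setminus\{0\}$). The origin is treated as part of the boundary on which boundary data are imposed ($\phi(0)=0$, $\phi>0$ on $\partial\Omega\setminus\{0\}$). Stochastic auxiliary problem. $\lambda>0$, a polynomial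 matrix $B$ with $B(0)=0$ and a covariance $\Sigma_\epsilon$ are chosen with $\lambda GR^{-1}G^T=B\Sigma_\epsilon B^T=:\Sigma(x)=\Sigma_t$; this corresponds to the dynamics $dx_t=(f+Gu_t)\,dt+B\,d\omega_t$, with $\omega_t$ Brownian motion of covariance $\Sigma_\epsilon$. Put $\mathcal{L}(\Psi)=f^T\nabla_x\Psi+\frac12\mathrm{Tr}((\nabla_{xx}\Psi)\Sigma)$, $\psi=e^{-\phi/\lambda}$ on $\partial\Omega$. It is assumed that the linear equation $0=-\frac1\lambda q\Psi+\mathcal{L}(\Psi)$, $\Psi=\psi$ on $\partial\Omega$, and the HJB equation $0=q+(\nabla_xV)^Tf-\frac12(\nabla_xV)^TGR^{-1}G^T\nabla_xV+\frac12\mathrm{Tr}((\nabla_{xx}V)\Sigma)$, $V=\phi$ on $\partial\Omega$, have unique nontrivial viscosity solutions $\Psi^*$ and $V^*=-\lambda\log\Psi^*$, the latter being the value function of the stochastic problem with cost $\mathbb{E}[\phi(x_T)+\int_0^Tq+\frac12u^TRu\,dt]$. $\mathbb{S}[x]$ is the set of sums of squares of real polynomials. $\Psi_l$ is understood to be positive so that its logarithm is defined. Operators. For a set $\{g_1\ge0,\dots,g_k\ge0\}=\Omega$ and $\mathcal{S}=\{s_\nu\in\mathbb{S}[x]:\nu\in\{0,1\}^k\}$, $\mathcal{D}(\Omega,\mathcal{S})=\sum_{\nu}s_\nu g_1^{\nu_1}\cdots g_k^{\nu_k}$. For a polynomial $p$ and $\mathcal{T}=\{t_1,\dots,t_m\}\subset\mathbb{R}[x]$,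 $\mathcal{B}(p,\partial\Omega,\mathcal{T})=\{p-t_ih_i:i=1,\dots,m\}$; $\mathcal{B}(\cdot)\in\mathbb{S}[x]$ means every element is in $\mathbb{S}[x]$ ($\psi$ being represented by a polynomial on $\partial\Omega$ when $\mathcal{B}$ is applied). SOS program (P): minimize $\epsilon$ over polynomials $\Psi_l,\Psi_u$, and $\mathcal{S}=(\mathcal{S}_1,\dots,\mathcal{S}_5)$ (sets of SOS polynomials), $\mathcal{T}=(\mathcal{T}_1,\mathcal{T}_2,\mathcal{T}_3)$ (sets of polynomials), all of bounded degree $d$, subject to: $-\frac1\lambda q\Psi_l+\mathcal{L}(\Psi_l)-\mathcal{D}(\Omega,\mathcal{S}_1)\in\mathbb{S}[x]$; $\frac1\lambda q\Psi_u-\mathcal{L}(\Psi_u)-\mathcal{D}(\Omega,\mathcal{S}_2)\in\mathbb{S}[x]$; $\epsilon-(\Psi_u-\Psi_l)-\mathcal{D}(\Omega,\mathcal{S}_3)\in\mathbb{S}[x]$; $\mathcal{B}(\Psi_l,\partial\Omega,\mathcal{T}_1)\in\mathbb{S}[x]$; $\mathcal{B}(\psi-\Psi_l,\partial\Omega,\mathcal{T}_2)\in\mathbb{S}[x]$; $\mathcal{B}(\Psi_u-\psi,\partial\Omega,\mathcal{T}_3)\in\mathbb{S}[x]$; for each coordinate $x^i$: $-\partial_{x^i}\Psi_l-\mathcal{D}(\Omega\cap\{x^i\ge0\},\mathcal{S}_4)\in\mathbb{S}[x]$ and $\partial_{x^i}\Psi_l-\mathcal{D}(\Omega\cap\{-x^i\ge0\},\mathcal{S}_5)\in\mathbb{S}[x]$;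 $\Psi_l(0)=1$. A controller is (asymptotically) stabilizing for the deterministic system if the equilibrium $x=0$ of the controlled system is (asymptotically) stable in the usual Lyapunov sense.
   Formalization: Stability in the usual sense on R^n is stated when the origin is interior to Ω; if the origin lies on the topological boundary of Ω (where the claim can fail, e.g. Ω=[0,1], f=-2x², G=x²), it is stated for trajectories while they remain in Ω. *)

(* Defs.v *)
From HB Require Import structures.
From mathcomp Require Import all_boot all_order all_algebra.
(* The notations of mpoly clash with those of MathComp-Analysis: everything but
   the notations is imported. *)
From mathcomp.multinomials Require Import -(notations) mpoly.
From mathcomp Require Import all_classical all_reals all_analysis.
Import numFieldNormedType.Exports.
Import Order.TTheory GRing.Theory Num.Theory.

Set Implicit Arguments.
Unset Strict Implicit.
Unset Printing Implicit Defensive.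

Local Open Scope classical_set_scope.
Local Open Scope ring_scope.

Section Polynomials.
Variables (R : realType) (n : nat).
Local Notation P := (mpoly n R).

Definition peval (p : P) (x : 'cV[R]_n) : R := meval (fun i => x i 0) p.

Definition mxeval (a b : nat) (A : 'M[P]_(a, b)) (x : 'cV[R]_n) : 'M[R]_(a, b) :=
  \matrix_(i, j) peval (A i j) x.

Definition mxconst (a b : nat) (A : 'M[R]_(a, b)) : 'M[P]_(a, b) :=
  \matrix_(i, j) mpolyC n (A i j).

Definition pvar (i : 'I_n) : P := mpolyX R (mnm1 i).

(* msize is the total degree plus one *)
Definition deg_le (d : nat) (p : P) : Prop := (msize p <= d.+1)%N.

Definition is_sos (p : P) : Prop := exists s : seq P, p = \sum_(r <- s) r ^+ 2.

Definition semialg (k : nat) (g : 'I_k -> P) : set 'cV[R]_n :=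
  [set x | forall i, 0 <= peval (g i) x].

Definition pd_on (Omega : set 'cV[R]_n) (p : P) : Prop :=
  peval p 0 = 0 /\ forall x, Omega x -> x != 0 -> 0 < peval p x.

End Polynomials.

Section LinearAlgebra.
Variables (R : realType) (p : nat).

Definition sym_posdef (A : 'M[R]_p) : Prop :=
  A^T = A /\ forall v : 'cV[R]_p, v != 0 -> 0 < (v^T *m A *m v) 0 0.

Definition covariance_mx (A : 'M[R]_p) : Prop :=
  A^T = A /\ forall v : 'cV[R]_p, 0 <= (v^T *m A *m v) 0 0.

End LinearAlgebra.

Section Calculus.
Variables (R : realType) (n : nat).
Implicit Types (V : 'cV[R]_n -> R) (x : 'cV[R]_n).

Definition partial (i : 'I_n) V x : R := 'D_(delta_mx i 0 : 'cV[R]_n) V x.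

Definition grad V x : 'cV[R]_n := \col_i partial i V x.

Definition hess V x : 'M[R]_n := \matrix_(i, j) partial i (partial j V) x.

(* The boundary of Omega, with the origin adjoined: boundary data are imposed
   at the origin too. *)
Definition bdry0 (Omega : set 'cV[R]_n) : set 'cV[R]_n :=
  (closure Omega `\` interior Omega) `|` [set 0].

End Calculus.

(* Viscosity solutions of F(x, u, Du, D^2u) = 0 in the sense of Crandall, Ishii
   and Lions, for F degenerate elliptic (nonincreasing in the Hessian) and O
   open, with the boundary condition u = b taken pointwise on D. *)
Section Viscosity.
Variables (R : realType) (n : nat).
Implicit Types (u b : 'cV[R]_n -> R) (x y : 'cV[R]_n).

Definition taylor2 u x (a : 'cV[R]_n) (X : 'M[R]_n) y : R :=
  u x + (a^T *m (y - x)) 0 0 + 2^-1 * ((y - x)^T *m X *m (y - x)) 0 0.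

Definition superjet u x (a : 'cV[R]_n) (X : 'M[R]_n) : Prop :=
  X^T = X /\ forall e, 0 < e ->
    \forall y \near x, u y <= taylor2 u x a X y + e * `|y - x| ^+ 2.

Definition subjet u x (a : 'cV[R]_n) (X : 'M[R]_n) : Prop :=
  X^T = X /\ forall e, 0 < e ->
    \forall y \near x, taylor2 u x a X y - e * `|y - x| ^+ 2 <= u y.

Definition viscosity_solution (O D : set 'cV[R]_n)
    (F : 'cV[R]_n -> R -> 'cV[R]_n -> 'M[R]_n -> R) b u : Prop :=
  [/\ {within O `|` D, continuous u},
      forall x a X, O x -> superjet u x a X -> F x (u x) a X <= 0,
      forall x a X, O x -> subjet u x a X -> 0 <= F x (u x) a X &
      forall x, D x -> u x = b x].

(* uniqueness is that of the restriction to O `|` D *)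
Definition unique_nontrivial_viscosity_solution (O D : set 'cV[R]_n)
    (F : 'cV[R]_n -> R -> 'cV[R]_n -> 'M[R]_n -> R) b u : Prop :=
  [/\ viscosity_solution O D F b u,
      exists2 x, (O `|` D) x & u x != 0 &
      forall v, viscosity_solution O D F b v ->
        forall x, (O `|` D) x -> v x = u x].

End Viscosity.

Section Equations.
Variables (R : realType) (n p : nat).
Local Notation P := (mpoly n R).
Variables (lam : R) (q : P) (f : 'cV[P]_n) (G : 'M[P]_(n, p)) (Rm : 'M[R]_p)
  (Sigma : 'M[P]_n).

(* 0 = - q Psi / lam + L(Psi), with the sign that makes it degenerate elliptic *)
Definition linear_pde (x : 'cV[R]_n) (r : R) (a : 'cV[R]_n) (X : 'M[R]_n) : R :=
  lam^-1 * peval q x * r - ((mxeval f x)^T *m a) 0 0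
  - 2^-1 * \tr (X *m mxeval Sigma x).

(* the Hamilton-Jacobi-Bellman equation, with the same sign convention *)
Definition hjb_pde (x : 'cV[R]_n) (r : R) (a : 'cV[R]_n) (X : 'M[R]_n) : R :=
  - peval q x - (a^T *m mxeval f x) 0 0
  + 2^-1 * (a^T *m mxeval G x *m invmx Rm *m (mxeval G x)^T *m a) 0 0
  - 2^-1 * \tr (X *m mxeval Sigma x).

Definition Lop (Psi : P) : P :=
  \sum_i f i 0 * mderiv i Psi
  + 2^-1 *: \tr ((\matrix_(i, j) (mderiv i (mderiv j Psi) : P)) *m Sigma).

End Equations.

Section SosProgram.
Variables (R : realType) (n : nat).
Local Notation P := (mpoly n R).

Definition Dop (k : nat) (g : 'I_k -> P) (s : {ffun 'I_k -> bool} -> P) : P :=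
  \sum_(nu : {ffun 'I_k -> bool}) s nu * \prod_(i < k) g i ^+ nu i.

(* the inequalities g together with c >= 0, in last position *)
Definition adjoin (k : nat) (g : 'I_k -> P) (c : P) (j : 'I_k.+1) : P :=
  if unlift ord_max j is Some i then g i else c.

Definition Bsos (m : nat) (c : P) (h t : 'I_m -> P) : Prop :=
  forall i, is_sos (c - t i * h i).

Record sos_vars (k m : nat) := SosVars {
  Psi_u : P;
  Psi_l : P;
  S1 : {ffun 'I_k -> bool} -> P;
  S2 : {ffun 'I_k -> bool} -> P;
  S3 : {ffun 'I_k -> bool} -> P;
  S4 : {ffun 'I_k.+1 -> bool} -> P;
  S5 : {ffun 'I_k.+1 -> bool} -> P;
  T1 : 'I_m -> P;
  T2 : 'I_m -> P;
  T3 : 'I_m -> P;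
  eps : R }.

Variables (k m d : nat) (lam : R) (q psi : P) (f : 'cV[P]_n) (Sigma : 'M[P]_n)
  (g : 'I_k -> P) (h : 'I_m -> P).

Definition sos_deg (I : Type) (s : I -> P) : Prop :=
  forall i, is_sos (s i) /\ deg_le d (s i).

Definition all_deg (I : Type) (t : I -> P) : Prop := forall i, deg_le d (t i).

Record sos_feasible (v : sos_vars k m) : Prop := SosFeasible {
  deg_Psi_u : deg_le d (Psi_u v);
  deg_Psi_l : deg_le d (Psi_l v);
  sos_S1 : sos_deg (S1 v);
  sos_S2 : sos_deg (S2 v);
  sos_S3 : sos_deg (S3 v);
  sos_S4 : sos_deg (S4 v);
  sos_S5 : sos_deg (S5 v);
  deg_T1 : all_deg (T1 v);
  deg_T2 : all_deg (T2 v);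
  deg_T3 : all_deg (T3 v);
  con_sub : is_sos (- (lam^-1 *: (q * Psi_l v)) + Lop f Sigma (Psi_l v)
                    - Dop g (S1 v));
  con_super : is_sos (lam^-1 *: (q * Psi_u v) - Lop f Sigma (Psi_u v)
                      - Dop g (S2 v));
  con_gap : is_sos (mpolyC n (eps v) - (Psi_u v - Psi_l v) - Dop g (S3 v));
  con_bd_nonneg : Bsos (Psi_l v) h (T1 v);
  con_bd_sub : Bsos (psi - Psi_l v) h (T2 v);
  con_bd_super : Bsos (Psi_u v - psi) h (T3 v);
  con_mono_pos : forall i,
    is_sos (- mderiv i (Psi_l v) - Dop (adjoin g (pvar R i)) (S4 v));
  con_mono_neg : forall i,
    is_sos (mderiv i (Psi_l v) - Dop (adjoin g (- pvar R i)) (S5 v));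
  con_origin : peval (Psi_l v) 0 = 1 }.

Definition sos_solution (v : sos_vars k m) : Prop :=
  sos_feasible v /\ forall w, sos_feasible w -> eps v <= eps w.

End SosProgram.

Section Stability.
Variables (R : realType) (n : nat).
Implicit Types (X : set 'cV[R]_n) (F : 'cV[R]_n -> 'cV[R]_n).

(* x solves x' = F(x) on [0, tau[ (tau may be +oo) and stays in X; the values of
   x outside [0, tau[ are irrelevant *)
Definition trajectory X F (tau : \bar R) (x : R -> 'cV[R]_n) : Prop :=
  [/\ {within [set t | 0 <= t /\ (t%:E < tau)%E], continuous x},
      forall t, 0 <= t -> (t%:E < tau)%E -> X (x t) &
      forall t, 0 < t -> (t%:E < tau)%E -> is_derive t 1 x (F (x t))].

(* The norm on 'cV[R]_n is the max norm; stability does not depend on the norm.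
   With X = setT this is the usual notion on R^n. *)
Definition stable_eq X F : Prop :=
  F 0 = 0 /\
  forall e, 0 < e -> exists2 del, 0 < del &
    forall tau x, trajectory X F tau x -> `|x 0| < del ->
      forall t, 0 <= t -> (t%:E < tau)%E -> `|x t| < e.

Definition asymp_stable_eq X F : Prop :=
  stable_eq X F /\
  exists2 del, 0 < del &
    forall x, trajectory X F +oo%E x -> `|x 0| < del ->
      x t @[t --> +oo] --> (0 : 'cV[R]_n).

Variable p : nat.
Variables (f : 'cV[mpoly n R]_n) (G : 'M[mpoly n R]_(n, p)).

Definition closed_loop (u : 'cV[R]_n -> 'cV[R]_p) (x : 'cV[R]_n) : 'cV[R]_n :=
  mxeval f x + mxeval G x *m u x.

Definition stabilizing X (u : 'cV[R]_n -> 'cV[R]_p) : Prop :=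
  stable_eq X (closed_loop u).

Definition asymp_stabilizing X (u : 'cV[R]_n -> 'cV[R]_p) : Prop :=
  asymp_stable_eq X (closed_loop u).

End Stability.

Definition Vupper (R : realType) (n : nat) (lam : R) (Psil : mpoly n R)
    (x : 'cV[R]_n) : R := - lam * ln (peval Psil x).

Definition feedback (R : realType) (n p : nat) (Rm : 'M[R]_p)
    (G : 'M[mpoly n R]_(n, p)) (V : 'cV[R]_n -> R) (x : 'cV[R]_n) : 'cV[R]_p :=
  - (invmx Rm *m (mxeval G x)^T *m grad V x).

(* Main.v *)
Require Import Defs.
From HB Require Import structures.
From mathcomp Require Import all_boot all_order all_algebra.
From mathcomp.multinomials Require Import -(notations) mpoly.
From mathcomp Require Import all_classical all_reals all_analysis.
From mathcomp Require Import ring lra.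
Import numFieldNormedType.Exports.
Import Order.TTheory GRing.Theory Num.Theory.

(** The Lyapunov function is W = 1 - Psi_l.  It is an increasing function of
    V_u = - lam * ln Psi_l, but it is a polynomial, so that its derivative along
    a trajectory comes from the chain rule for polynomials; the logarithm only
    has to be differentiated to read the feedback and the trace hypothesis in
    terms of the gradient a and the Hessian H of Psi_l:
    grad V_u = - lam a / Psi_l and
    hess V_u = - lam (H / Psi_l - a a^T / Psi_l^2).
    The trace hypothesis thus says Tr (H Sigma) <= a^T Sigma a / Psi_l, and,
    since lam G R^-1 G^T = Sigma, the closed loop is
    F = f + Sigma a / Psi_l.

    Decay.  The first SOS constraint gives, on Omega,
    q Psi_l / lam <= a^T f + Tr (H Sigma) / 2.  Bounding the trace by the
    hypothesis and using a^T Sigma a >= 0 (Sigma is a covariance), the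
    derivative a^T F of Psi_l along the closed loop is at least q Psi_l / lam,
    which is positive off the origin ([subsolution_growth]).

    Positivity.  W is positive on Omega minus the origin by a maximum principle
    ([subsolution_lt1]).  At a maximum of Psi_l over the compact Omega that is
    an interior point other than 0, a = 0, so Tr (H Sigma) <= 0 and the same SOS
    constraint forces q <= 0, which is absurd.  At a boundary point other than 0
    the boundary constraint gives Psi_l <= exp (- phi / lam) < 1.  As
    Psi_l 0 = 1, the maximum of Psi_l is 1, reached at 0 alone.  This argument
    covers the case where 0 lies on the topological boundary of Omega.

    Lyapunov's direct method ([lyapunov_stable], [lyapunov_attractive]) then
    yields asymptotic stability of the flow restricted to Omega, the running
    cost q being what makes the decay strict off the origin.  When 0 is
    interior to Omega, a trajectory that starts close to 0 cannot leave Omega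
    ([stable_eq_setT], [asymp_stable_eq_setT]), which gives stability in the
    whole space. *)

Set Implicit Arguments.
Unset Strict Implicit.
Unset Printing Implicit Defensive.

Local Open Scope classical_set_scope.
Local Open Scope ring_scope.

(** * Polynomials as functions on column vectors *)

Section PolynomialFunctions.
Variables (R : realType) (n : nat).
Local Notation P := (mpoly n R).
Implicit Types (p : P) (x : 'cV[R]_n).

(** The induction principle for facts stable under sums and products, such as
    continuity and the chain rule: the variables generate the monomials. *)
Lemma mpoly_subring_ind (Q : P -> Prop) :
    (forall c, Q (mpolyC n c)) -> (forall i, Q (pvar R i)) ->
    (forall p1 p2, Q p1 -> Q p2 -> Q (p1 + p2)) ->
    (forall p1 p2, Q p1 -> Q p2 -> Q (p1 * p2)) ->
  forall p, Q p.
Proof.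
move=> QC QX QD QM; apply: mpolyind => [|c m p _ _ Qp].
  by rewrite -(mpolyC0 n R).
apply: (QD) => //; rewrite -mul_mpolyC; apply: (QM) => //.
rewrite mpolyXE_id.
apply: (big_ind Q) => [|p1 p2|i _]; [exact: (QC 1)|exact: QM|].
elim: (m i) => [|k IHk]; first exact: (QC 1).
by rewrite exprS; apply: (QM) => //; exact: QX.
Qed.

Lemma pevalC c x : peval (mpolyC n c) x = c.
Proof. exact: mevalC. Qed.

Lemma pevalD p1 p2 x : peval (p1 + p2) x = peval p1 x + peval p2 x.
Proof. exact: mevalD. Qed.

Lemma pevalN p x : peval (- p) x = - peval p x.
Proof. exact: mevalN. Qed.

Lemma pevalM p1 p2 x : peval (p1 * p2) x = peval p1 x * peval p2 x.
Proof. exact: mevalM. Qed.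

Lemma pevalZ c p x : peval (c *: p) x = c * peval p x.
Proof. exact: mevalZ. Qed.

Lemma peval_var i x : peval (pvar R i) x = x i 0.
Proof. exact: mevalXU. Qed.

Lemma peval_sum (I : Type) (s : seq I) (F : I -> P) x :
  peval (\sum_(i <- s) F i) x = \sum_(i <- s) peval (F i) x.
Proof. exact: (raddf_sum (meval (fun i => x i 0))). Qed.

Lemma peval_prod (I : Type) (s : seq I) (F : I -> P) x :
  peval (\prod_(i <- s) F i) x = \prod_(i <- s) peval (F i) x.
Proof. exact: (rmorph_prod (meval (fun i => x i 0))). Qed.

Lemma pevalX p k x : peval (p ^+ k) x = peval p x ^+ k.
Proof. exact: (rmorphXn (meval (fun i => x i 0))). Qed.

Lemma mxevalE a b (A : 'M[P]_(a, b)) x :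
  mxeval A x = map_mx (meval (fun i => x i 0)) A.
Proof. by apply/matrixP => i j; rewrite !mxE. Qed.

Lemma mxevalM a b c (A : 'M[P]_(a, b)) (A' : 'M[P]_(b, c)) x :
  mxeval (A *m A') x = mxeval A x *m mxeval A' x.
Proof. by rewrite !mxevalE map_mxM. Qed.

Lemma mxevalZ a b c (A : 'M[P]_(a, b)) x :
  mxeval (mpolyC n c *: A) x = c *: mxeval A x.
Proof. by apply/matrixP => i j; rewrite !mxE pevalM pevalC. Qed.

Lemma mxeval_tr a b (A : 'M[P]_(a, b)) x : mxeval A^T x = (mxeval A x)^T.
Proof. by rewrite !mxevalE map_trmx. Qed.

Lemma mxeval_const a b (A : 'M[R]_(a, b)) x : mxeval (mxconst n A) x = A.
Proof. by apply/matrixP => i j; rewrite !mxE pevalC. Qed.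

Lemma peval_continuous p : continuous (peval p).
Proof.
elim/mpoly_subring_ind: p => [c|i|p1 p2 c1 c2|p1 p2 c1 c2] x.
- rewrite (_ : peval _ = cst c); first exact: cst_continuous.
  by apply/funext => y; exact: pevalC.
- rewrite (_ : peval _ = fun y => y i 0); first exact: coord_continuous.
  by apply/funext => y; exact: peval_var.
- rewrite (_ : peval _ = peval p1 \+ peval p2).
    by apply: continuousD; [exact: c1|exact: c2].
  by apply/funext => y; exact: pevalD.
- rewrite (_ : peval _ = peval p1 \* peval p2).
    by apply: continuousM; [exact: c1|exact: c2].
  by apply/funext => y; exact: pevalM.
Qed.

Lemma sos_ge0 p x : is_sos p -> 0 <= peval p x.
Proof.
by case=> s ->; rewrite peval_sum sumr_ge0// => r _; rewrite pevalX sqr_ge0.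
Qed.

Lemma Dop_ge0 k (g : 'I_k -> P) (s : {ffun 'I_k -> bool} -> P) x :
  (forall nu, is_sos (s nu)) -> semialg g x -> 0 <= peval (Dop g s) x.
Proof.
move=> sos_s gx; rewrite peval_sum sumr_ge0// => nu _.
rewrite pevalM peval_prod mulr_ge0 ?sos_ge0//; apply: prodr_ge0 => i _.
by rewrite pevalX exprn_ge0.
Qed.

Lemma semialg_le k (g : 'I_k -> P) (s : {ffun 'I_k -> bool} -> P) p x :
    (forall nu, is_sos (s nu)) -> is_sos (p - Dop g s) -> semialg g x ->
  0 <= peval p x.
Proof.
move=> sos_s /sos_ge0-/(_ x); rewrite pevalD pevalN subr_ge0 => + gx.
exact/le_trans/Dop_ge0.
Qed.

End PolynomialFunctions.

(** * Derivatives of polynomials along curves and of their logarithms *)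

Section Derivatives.
Variable R : realType.

(** Directional derivatives are derivatives of a function of one real variable,
    to which the one-dimensional chain rule and Fermat's rule apply. *)
Lemma is_derive_line (V W : normedModType R) (f : V -> W) x v df :
  is_derive x v f df <-> is_derive (0 : R) 1 (fun h : R => f (h *: v + x)) df.
Proof.
have E : 'D_v f x = 'D_1 (fun h : R => f (h *: v + x)) 0.
  rewrite /derive; set g1 := fun h => h^-1 *: _; set g2 := fun h => h^-1 *: _.
  suff -> : g1 = g2 by [].
  by apply/funext => h; rewrite /g1 /g2 /= addr0 scale0r add0r [_%:A]mulr1.
have /= [D01 D10] := derivable1P f x v.
by split=> -[D <-]; apply: DeriveDef; rewrite ?E//; [exact: D01|exact: D10].
Qed.

Lemma is_derive_coord (V : normedModType R) a b (y : V -> 'M[R]_(a, b)) t v dy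
    i j :
  is_derive t v y dy -> is_derive t v (fun s => y s i j) (dy i j).
Proof.
move=> [D <-]; apply: DeriveDef; first exact: (derivable_mxP _ _ _).1 D i j.
by rewrite derive_mx// mxE.
Qed.

Lemma is_derive_ln (V : normedModType R) (f : V -> R) x v df :
  0 < f x -> is_derive x v f df -> is_derive x v (fun y => ln (f y)) (df / f x).
Proof.
move=> fx0 /is_derive_line D; apply/is_derive_line.
rewrite mulrC.
have Dln : is_derive (f (0 *: v + x)) 1 (@ln R) (f x)^-1.
  by rewrite scale0r add0r; exact: is_derive1_ln.
exact: (@is_derive1_comp R (@ln R) _ 0 _ _ Dln D).
Qed.

(** The curve is parametrised by any normed module, so that this serves both for
    trajectories (a real parameter) and for partial derivatives (the identity
    curve). *)
Lemma is_derive_peval (V : normedModType R) n (p : mpoly n R)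
    (y : V -> 'cV[R]_n) t v dy :
    is_derive t v y dy ->
  is_derive t v (peval p \o y) (\sum_i peval (mderiv i p) (y t) * dy i 0).
Proof.
move=> Dy; elim/mpoly_subring_ind: p => [c|i|p1 p2 D1 D2|p1 p2 D1 D2].
- rewrite (_ : _ \o _ = cst c).
    apply: is_derive_eq; rewrite big1// => i _.
    by rewrite mderivC /peval meval0 mul0r.
  by apply/funext => s; exact: pevalC.
- rewrite (_ : _ \o _ = fun s => y s i 0).
    apply: is_derive_eq (is_derive_coord i 0 Dy) _.
    rewrite (bigD1 i)//= big1 => [|j ji]; rewrite /pvar mderivX mnm1E.
      rewrite eqxx scale1r addr0 (_ : mnm_sub _ _ = mnm0).
        by rewrite mpolyX0 /peval meval1 mul1r.
      by apply/mnmP => k; rewrite mnmBE mnm0E subnn.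
    by rewrite eq_sym (negPf ji) scale0r /peval meval0 mul0r.
  by apply/funext => s; exact: peval_var.
- rewrite (_ : _ \o _ = (peval p1 \o y) + (peval p2 \o y)).
    apply: is_derive_eq; rewrite -big_split; apply: eq_bigr => i _ /=.
    by rewrite mderivD pevalD mulrDl.
  by apply/funext => s; exact: pevalD.
- rewrite (_ : _ \o _ = (peval p1 \o y) * (peval p2 \o y)).
    apply: is_derive_eq.
    rewrite !scaler_sumr -big_split; apply: eq_bigr => i _ /=.
    by rewrite mderivM pevalD !pevalM /GRing.scale/=; ring.
  by apply/funext => s; exact: pevalM.
Qed.

End Derivatives.

(** * Lyapunov's direct method with a polynomial Lyapunov function *)

Section Lyapunov.
Variables (R : realType) (n : nat).
Local Notation P := (mpoly n R).
Implicit Types (Omega : set 'cV[R]_n) (F : 'cV[R]_n -> 'cV[R]_n) (w r : P).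

(** The left-hand side is the derivative of w along the flow of F. *)
Definition lyapunov_decay Omega F w r : Prop :=
  forall x, Omega x ->
    \sum_i peval (mderiv i w) x * F x i 0 <= - peval r x.

Lemma pd_ge0 Omega w x : pd_on Omega w -> Omega x -> 0 <= peval w x.
Proof.
move=> [w0 w_gt0] Ox; have [->|x0] := eqVneq x 0; first by rewrite w0.
exact/ltW/w_gt0.
Qed.

(** By compactness: this replaces the usual class-K lower bounds, both for the
    Lyapunov function (to turn small values into small norms) and for its
    decay rate (to force trajectories towards the origin). *)
Lemma pd_away_from0 Omega w e :
    compact Omega -> pd_on Omega w -> 0 < e ->
  exists2 a, 0 < a & forall x, Omega x -> e <= `|x| -> a <= peval w x.
Proof.
move=> cO [_ w_gt0] e0.
pose K := Omega `&` [set x : 'cV[R]_n | e <= `|x|].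
have [K0|/set0P/negP/negPn/eqP K0] := pselect (K !=set0); last first.
  exists 1 => // x Ox ex; have : K x by [].
  by rewrite K0.
have cK : compact K.
  apply: compact_closedI => //.
  apply: (@closed_comp _ _ (fun x : 'cV[R]_n => `|x|) [set y | e <= y]).
    by move=> x _; exact: norm_continuous.
  exact: closed_ge.
have [c cinK cmin] := compact_EVT_min K0 cK
  (continuous_subspaceT (@peval_continuous _ _ w)).
move: cinK; rewrite inE => -[Oc ec].
exists (peval w c).
  by apply: w_gt0 => //; rewrite -normr_gt0 (lt_le_trans e0).
by move=> x Ox ex; apply: cmin; rewrite inE.
Qed.

Lemma small_near0 w a :
    peval w 0 = 0 -> 0 < a ->
  exists2 del, 0 < del & forall x : 'cV[R]_n, `|x| < del -> peval w x < a.
Proof.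
move=> w0 a0; have /cvgrPdist_lt/(_ _ a0) := @peval_continuous _ _ w 0.
move=> /nbhs_ballP[del del0 near0]; exists del => // x xdel.
have : ball (0 : 'cV[R]_n) del x by rewrite -ball_normE /= sub0r normrN.
by move=> /near0/=; rewrite w0 sub0r normrN; exact/le_lt_trans/ler_norm.
Qed.

(** The mean value theorem.  The intermediate time is kept, since the decay rate
    has a positive lower bound only away from the origin. *)
Lemma decay_along_trajectory Omega F w r tau x s t :
    lyapunov_decay Omega F w r -> trajectory Omega F tau x ->
    0 <= s -> s < t -> (t%:E < tau)%E ->
  exists2 c, s < c < t &
    peval w (x t) <= peval w (x s) - peval r (x c) * (t - s).
Proof.
move=> wdecay [x_cont x_in x_der] s0 st ttau.
have before u : u <= t -> (u%:E < tau)%E.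
  by move=> ut; rewrite (le_lt_trans _ ttau)// lee_fin.
have w_der u : u \in `]s, t[ -> is_derive u 1 (peval w \o x)
    (\sum_i peval (mderiv i w) (x u) * F (x u) i 0).
  rewrite in_itv/= => /andP[su ut]; apply: is_derive_peval; apply: x_der.
    exact: le_lt_trans su.
  exact/before/ltW.
have w_cont : {within `[s, t], continuous (peval w \o x)}.
  apply: within_continuous_comp; first by move=> y _; exact: peval_continuous.
  apply: continuous_subspaceW x_cont => u /=; rewrite in_itv/= => /andP[su ut].
  by split; [exact: le_trans su|exact: before].
have [c] := MVT st w_der w_cont; rewrite in_itv/= => sct E; exists c => //.
have /andP[sc ct] := sct.
have Oc : Omega (x c).
  by apply: x_in; [exact/ltW/(le_lt_trans s0)|exact/before/ltW].
rewrite -lerBlDl -mulNr [leLHS]E ler_pM2r ?subr_gt0//; exact: wdecay.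
Qed.

Lemma nonincreasing_along_trajectory Omega F w r tau x s t :
    pd_on Omega r -> lyapunov_decay Omega F w r -> trajectory Omega F tau x ->
    0 <= s -> s <= t -> (t%:E < tau)%E ->
  peval w (x t) <= peval w (x s).
Proof.
move=> r_pd wdecay xtraj s0; rewrite le_eqVlt => /predU1P[->//|st] ttau.
have [c /andP[sc ct]] := decay_along_trajectory wdecay xtraj s0 st ttau.
move=> /le_trans; apply; rewrite gerBl mulr_ge0 ?subr_ge0 ?(ltW st)//.
have [_ x_in _] := xtraj; apply: (pd_ge0 r_pd); apply: x_in.
  exact/ltW/(le_lt_trans s0).
by rewrite (lt_trans _ ttau)// lte_fin.
Qed.

Lemma lyapunov_stable Omega F w r :
    compact Omega -> F 0 = 0 -> pd_on Omega w -> pd_on Omega r ->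
    lyapunov_decay Omega F w r ->
  stable_eq Omega F.
Proof.
move=> cO F0 w_pd r_pd wdecay; split=> // e e0.
have [a a0 w_far] := pd_away_from0 cO w_pd e0.
have [del del0 w_near] := small_near0 w_pd.1 a0.
exists del => // tau x xtraj x0 t t0 ttau; have [_ x_in _] := xtraj.
rewrite ltNge; apply/negP => /(w_far _ (x_in _ t0 ttau)); apply/negP.
rewrite -ltNge (le_lt_trans _ (w_near _ x0))//.
exact: (nonincreasing_along_trajectory r_pd wdecay xtraj).
Qed.

(** A trajectory that stayed away from the origin would lose a fixed amount of w
    per unit of time, and w would become negative; so it comes arbitrarily close
    to the origin, where w is small, and w never increases afterwards. *)
Lemma lyapunov_attractive Omega F w r x :
    compact Omega -> pd_on Omega w -> pd_on Omega r ->
    lyapunov_decay Omega F w r -> trajectory Omega F +oo%E x ->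
  x t @[t --> +oo] --> (0 : 'cV[R]_n).
Proof.
move=> cO w_pd r_pd wdecay xtraj; have [_ x_in _] := xtraj.
apply/cvgr0Pnorm_lt => e e0.
have [a a0 w_far] := pd_away_from0 cO w_pd e0.
have [del del0 w_near] := small_near0 w_pd.1 a0.
have [t0 t0_ge0 xt0] : exists2 t0, 0 <= t0 & `|x t0| < del.
  apply: contrapT => x_away.
  have [b b0 r_far] := pd_away_from0 cO r_pd del0.
  (* by this time a decay at rate b has brought w below 0 *)
  pose t := (peval w (x 0) + 1) / b.
  have w0_ge0 : 0 <= peval w (x 0).
    by apply: (pd_ge0 w_pd); apply: x_in; rewrite ?ltry.
  have t_gt0 : 0 < t by rewrite divr_gt0// ltr_pwDr.
  have [c /andP[c0 _]] :=
    decay_along_trajectory wdecay xtraj (lexx 0) t_gt0 (ltry _).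
  have b_le : b <= peval r (x c).
    apply: r_far; first by apply: x_in; rewrite ?ltry ?ltW.
    by rewrite leNgt; apply/negP => ?; apply: x_away; exists c; rewrite // ltW.
  apply/negP; rewrite -ltNge subr0.
  apply: (@lt_le_trans _ _ 0); last first.
    by apply: (pd_ge0 w_pd); apply: x_in; rewrite ?ltry ?ltW.
  rewrite subr_lt0 (@lt_le_trans _ _ (b * t))//; last by rewrite ler_pM2r.
  by rewrite /t mulrC divfK ?gt_eqF// ltrDl.
near=> t.
have t0t : t0 <= t by near: t; exact/nbhs_pinfty_ge/num_real.
rewrite ltNge; apply/negP => /(w_far _ (x_in _ (le_trans t0_ge0 t0t) (ltry _))).
apply/negP; rewrite -ltNge (le_lt_trans _ (w_near _ xt0))//.
exact: (nonincreasing_along_trajectory r_pd wdecay xtraj t0_ge0 t0t (ltry _)).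
Unshelve. all: by end_near. Qed.

(** The set of times at which y is at least c is compact, hence has a least
    element. *)
Lemma first_reach (y : R -> R) (a b c : R) :
    a <= b -> {within `[a, b], continuous y} -> c <= y b ->
  exists2 t, a <= t <= b & c <= y t /\ forall s, a <= s -> s < t -> y s < c.
Proof.
move=> ab y_cont cyb.
pose S := [set s | c <= y s] `&` `[a, b].
have S_compact : compact S.
  apply/compact_subspaceIP; rewrite setIC; apply: compact_closedI.
    have : compact (`[a, b]%classic `&` `[a, b]%classic).
      by rewrite setIid; exact: segment_compact.
    by move=> /compact_subspaceIP; rewrite setIid.
  apply: (@closed_comp _ _ (y : subspace `[a, b] -> R) [set u | c <= u]).
    by move=> s _; exact: y_cont.
  exact: closed_ge.
have Sb : S b by split=> //; rewrite /= in_itv/= ab lexx.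
have [|t] := @compact_EVT_min _ _ id _ (ex_intro _ b Sb) S_compact.
  by apply: continuous_subspaceT => s; exact: cvg_id.
rewrite inE /S /= in_itv/= => -[ct /andP[at_ tb]] tmin.
exists t; [by rewrite at_ tb|split=> // s as_ st].
rewrite ltNge; apply/negP => cs; have : s \in S.
  by rewrite inE; split=> //=; rewrite in_itv/= as_ (le_trans (ltW st) tb).
by move=> /tmin; rewrite leNgt st.
Qed.

Lemma trajectory_sub Omega F (tau tau' : \bar R) x :
    trajectory setT F tau x -> (tau' <= tau)%E ->
    (forall t, 0 <= t -> (t%:E < tau')%E -> Omega (x t)) ->
  trajectory Omega F tau' x.
Proof.
move=> [x_cont _ x_der] tau'tau x_in; split=> //.
  apply: continuous_subspaceW x_cont => t /= [t0 tt]; split=> //.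
  exact: lt_le_trans tau'tau.
by move=> t t0 tt; apply: x_der => //; exact: lt_le_trans tau'tau.
Qed.

(** A first-exit argument.  Up to the first time t1 at which the norm reaches d,
    the trajectory lies in a ball contained in Omega, so stability in Omega,
    used with the radius d / 2, bounds its norm by d / 2 on [0, t1[; but the
    intermediate value theorem gives a time before t1 at which the norm equals
    d / 2. *)
Lemma stable_eq_setT Omega F :
  interior Omega 0 -> stable_eq Omega F -> stable_eq setT F.
Proof.
move=> /nbhs_ballP[rho rho0 ball_sub] [F0 stab]; split=> // e e0.
pose d := Num.min e rho.
have d0 : 0 < d by rewrite lt_min e0.
have d20 : 0 < d / 2 by rewrite divr_gt0.
have d2d : d / 2 < d by rewrite ltr_pdivrMr// ltr_pMr// ltr1n.
have [del del0 small] := stab _ d20.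
exists (Num.min del (d / 2)) => [|tau x xtraj]; first by rewrite lt_min del0.
rewrite lt_min => /andP[x0del x0d] t t0 ttau.
suff : `|x t| < d by rewrite lt_min => /andP[].
rewrite ltNge; apply/negP => xt_ge.
have [x_cont _ _] := xtraj.
have nx_cont : {within `[0, t], continuous (fun s => `|x s|)}.
  apply: within_continuous_comp; first by move=> y _; exact: norm_continuous.
  apply: continuous_subspaceW x_cont => s /=; rewrite in_itv/= => /andP[s0 st].
  by split=> //; rewrite (le_lt_trans _ ttau)// lee_fin.
have [t1 /andP[t10 t1t] [xt1 before]] := first_reach t0 nx_cont xt_ge.
have xtraj1 : trajectory Omega F t1%:E x.
  apply: (trajectory_sub xtraj) => [|s s0].
    by rewrite ltW// (le_lt_trans _ ttau)// lee_fin.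
  rewrite lte_fin => st1; apply: ball_sub.
  rewrite -ball_normE /= sub0r normrN; have := before s s0 st1.
  by rewrite lt_min => /andP[].
have nx_cont1 : {within `[0, t1], continuous (fun s => `|x s|)}.
  by apply: continuous_subspaceW nx_cont; apply: subset_itvl; rewrite bnd_simp.
have [c] : exists2 c, c \in `[0, t1] & `|x c| = d / 2.
  apply: IVT => //; rewrite ge_min le_max (ltW x0d)/=.
  by rewrite (le_trans (ltW d2d) xt1) orbT.
rewrite in_itv/= => /andP[c0]; rewrite le_eqVlt => /predU1P[->|ct1] xc.
  by move: xt1; rewrite xc leNgt d2d.
by have := small _ _ xtraj1 x0del c c0; rewrite lte_fin xc ltxx => /(_ ct1).
Qed.

(** Stability in the whole space keeps a trajectory that starts near 0 in a ball
    contained in Omega, where attractivity is known. *)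
Lemma asymp_stable_eq_setT Omega F :
  interior Omega 0 -> asymp_stable_eq Omega F -> asymp_stable_eq setT F.
Proof.
move=> O0 [stab [del1 del1_gt0 attr]].
have stabT := stable_eq_setT O0 stab; split=> //.
have /nbhs_ballP[rho rho0 ball_sub] := O0.
have [del2 del2_gt0 small] := stabT.2 _ rho0.
exists (Num.min del1 del2) => [|x xtraj]; first by rewrite lt_min del1_gt0.
rewrite lt_min => /andP[x1 x2]; apply: attr => //.
apply: (trajectory_sub xtraj (lexx _)) => t t0 tt; apply: ball_sub.
by rewrite -ball_normE /= sub0r normrN; exact: small xtraj x2 _ t0 tt.
Qed.

End Lyapunov.

(** * The logarithmic transform of a polynomial *)

Section LogTransform.
Variables (R : realType) (n : nat) (lam : R).
Local Notation P := (mpoly n R).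
Implicit Types (p : P) (x : 'cV[R]_n).

Definition pgrad p x : 'cV[R]_n := \col_i peval (mderiv i p) x.

Definition phess p x : 'M[R]_n :=
  \matrix_(i, j) peval (mderiv i (mderiv j p)) x.

Lemma is_derive_partial p i x :
  is_derive x (delta_mx i 0 : 'cV[R]_n) (peval p) (peval (mderiv i p) x).
Proof.
apply: is_derive_eq (is_derive_peval p (is_derive_id x (delta_mx i 0))) _.
rewrite (bigD1 i)//= big1 => [|j ji]; rewrite mxE ?eqxx ?addr0 ?mulr1//.
by rewrite (negPf ji) mulr0.
Qed.

Lemma is_derive_Vupper p i x :
    0 < peval p x ->
  is_derive x (delta_mx i 0 : 'cV[R]_n) (Vupper lam p)
    (- lam * (peval (mderiv i p) x / peval p x)).
Proof.
move=> p_gt0; have D := is_derive_ln p_gt0 (is_derive_partial p i x).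
exact: (is_deriveZ (- lam) D).
Qed.

Lemma grad_Vupper p x :
  0 < peval p x -> grad (Vupper lam p) x = (- lam / peval p x) *: pgrad p x.
Proof.
move=> p_gt0; apply/colP => i; rewrite !mxE /partial.
by have [_ ->] := is_derive_Vupper i p_gt0; rewrite mulrA mulrAC.
Qed.

(** Second derivatives at x only see the first ones near x, where positivity of
    p persists and they are given by the quotient formula. *)
Lemma is_derive_partial_Vupper p i j x :
    0 < peval p x ->
  is_derive x (delta_mx i 0 : 'cV[R]_n) (partial j (Vupper lam p))
    (- lam * (peval (mderiv i (mderiv j p)) x / peval p x
      - peval (mderiv i p) x * peval (mderiv j p) x / peval p x ^+ 2)).
Proof.
move=> p_gt0.
pose V' y := - lam * (peval (mderiv j p) y * (peval p y)^-1).
have near_gt0 : \forall y \near x, 0 < peval p y.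
  exact: (cvgr_gt _ (@peval_continuous _ _ p x) _ p_gt0).
apply: (@near_eq_is_derive _ _ _ V'); last first.
  have D := is_derive_partial p i x.
  have p_neq0 : peval p x != 0 by rewrite gt_eqF.
  have DV : is_derive x (delta_mx i 0 : 'cV[R]_n) (fun y => (peval p y)^-1)
      (- peval p x ^- 2 *: peval (mderiv i p) x).
    apply: DeriveDef; first exact: derivableV.
    by rewrite deriveV// derive_val.
  have Dq := is_deriveM (is_derive_partial (mderiv j p) i x) DV.
  apply: is_derive_eq (is_deriveZ (- lam) Dq) _.
  by rewrite /GRing.scale/=; field.
near=> y; rewrite /V' /partial.
have p_gt0' : 0 < peval p y by near: y.
by have [_ ->] := is_derive_Vupper j p_gt0'.
Unshelve. all: by end_near. Qed.

Lemma hess_Vupper p x :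
    0 < peval p x ->
  hess (Vupper lam p) x =
    (- lam / peval p x) *:
      (phess p x - (peval p x)^-1 *: (pgrad p x *m (pgrad p x)^T)).
Proof.
move=> p_gt0; have p_neq0 : peval p x != 0 by rewrite gt_eqF.
apply/matrixP => i j; rewrite !mxE big_ord1 !mxE {1}/partial.
have [_ ->] := is_derive_partial_Vupper i j p_gt0.
by field.
Qed.

Lemma trace_rank1 (a : 'cV[R]_n) (S : 'M[R]_n) :
  \tr (a *m a^T *m S) = (a^T *m S *m a) 0 0.
Proof. by rewrite -mulmxA mxtrace_mulC /mxtrace big_ord1. Qed.

(** In this form the curvature hypothesis on the logarithmic transform no longer
    involves the logarithm. *)
Lemma trace_hess_Vupper p x (S : 'M[R]_n) :
    0 < lam -> 0 < peval p x ->
  0 <= \tr (hess (Vupper lam p) x *m S) =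
  (\tr (phess p x *m S) <=
     ((pgrad p x)^T *m S *m pgrad p x) 0 0 / peval p x).
Proof.
move=> lam0 p_gt0; rewrite hess_Vupper// -scalemxAl mxtraceZ.
rewrite mulNr mulNr oppr_ge0 pmulr_rle0 ?divr_gt0//.
rewrite mulmxBl -scalemxAl raddfB /= mxtraceZ trace_rank1 subr_le0.
by rewrite [in RHS]mulrC.
Qed.

Lemma peval_Lop (f : 'cV[P]_n) (Sigma : 'M[P]_n) p x :
  peval (Lop f Sigma p) x =
  ((pgrad p x)^T *m mxeval f x) 0 0 + 2^-1 * \tr (phess p x *m mxeval Sigma x).
Proof.
rewrite pevalD pevalZ; congr (_ + _ * _).
  rewrite peval_sum mxE; apply: eq_bigr => i _.
  by rewrite pevalM !mxE mulrC.
rewrite /mxtrace peval_sum; apply: eq_bigr => i _.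
rewrite !mxE peval_sum; apply: eq_bigr => j _.
by rewrite pevalM !mxE.
Qed.

End LogTransform.

Section Noise.
Variables (R : realType) (n r : nat).

(** The quadratic form is that of Seps at the vector B^T a. *)
Lemma noise_covariance_ge0 (B : 'M[mpoly n R]_(n, r)) (Seps : 'M[R]_r) x
    (a : 'cV[R]_n) :
    covariance_mx Seps ->
  0 <= (a^T *m mxeval (B *m mxconst n Seps *m B^T) x *m a) 0 0.
Proof.
move=> [_ Seps_ge0]; rewrite !mxevalM mxeval_tr mxeval_const.
have := Seps_ge0 ((mxeval B x)^T *m a).
by rewrite trmx_mul trmxK !mulmxA.
Qed.

End Noise.

(** * The lower SOS certificate as a Lyapunov function *)

Section Certificate.
Variables (R : realType) (n : nat).
Local Notation P := (mpoly n R).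
Implicit Types (Omega : set 'cV[R]_n) (p : P) (x : 'cV[R]_n).

Lemma pgrad_eq0_at_max Omega p x :
    interior Omega x -> (forall y, Omega y -> peval p y <= peval p x) ->
  pgrad p x = 0.
Proof.
move=> Ox xmax; apply/colP => i; rewrite !mxE.
pose v : 'cV[R]_n := delta_mx i 0.
pose y (t : R) : 'cV[R]_n := t *: v + x.
have /is_derive_line D0 := is_derive_partial p i x.
have y_cont : continuous y.
  by move=> t; apply: cvgD; [apply: scalel_continuous|exact: cvg_cst].
have : \forall t \near (0 : R), Omega (y t).
  by apply: y_cont; rewrite /y scale0r add0r.
move=> /nbhs_ballP[e e0 ball_sub].
have : is_derive (0 : R) 1 (peval p \o y) 0.
  apply: (@derive1_at_max _ _ (- e) e); rewrite ?in_itv/= ?oppr_lt0 ?e0//.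
  - by rewrite ge0_cp// ltW.
  - move=> t _; apply: ex_derive; apply: is_derive_peval.
    apply: derivableP; apply: derivableD; last exact: derivable_cst.
    exact/derivable1_diffP.
  - move=> t; rewrite in_itv/= => te.
    rewrite [in leRHS]/y scale0r add0r; apply/xmax/ball_sub.
    by rewrite -ball_normE /= sub0r normrN ltr_norml.
by move=> [_ <-]; case: D0.
Qed.

Section Feasible.
Variables (k m d : nat) (lam : R) (q psi : P) (f : 'cV[P]_n) (Sigma : 'M[P]_n).
Variables (g : 'I_k -> P) (h : 'I_m -> P) (v : sos_vars R n k m).

Lemma subsolution_on_semialg x :
    0 < lam -> sos_feasible d lam q psi f Sigma g h v -> semialg g x ->
  peval q x * peval (Psi_l v) x / lam <=
    ((pgrad (Psi_l v) x)^T *m mxeval f x) 0 0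
    + 2^-1 * \tr (phess (Psi_l v) x *m mxeval Sigma x).
Proof.
move=> lam0 feas gx.
have := semialg_le (fun nu => (sos_S1 feas nu).1) (con_sub feas) gx.
rewrite pevalD pevalN pevalZ pevalM peval_Lop addrC subr_ge0.
by rewrite mulrC.
Qed.

(** The product vanishes, so some h i does, and there the i-th boundary
    certificate reads psi - Psi_l = sum of squares. *)
Lemma subsolution_le_boundary_data x :
    sos_feasible d lam q psi f Sigma g h v ->
    \prod_(i < m) peval (h i) x = 0 ->
  peval (Psi_l v) x <= peval psi x.
Proof.
move=> feas /eqP; rewrite prodf_seq_eq0 => /hasP[i _ /andP[_ /eqP hi0]].
have := sos_ge0 x (con_bd_sub feas i).
by rewrite !(pevalD, pevalN) pevalM hi0 mulr0 subr0 subr_ge0.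
Qed.

End Feasible.

End Certificate.

Section LyapunovCertificate.
Variables (R : realType) (n : nat) (lam : R) (q Psi : mpoly n R).
Variables (f : 'cV[mpoly n R]_n) (S : 'cV[R]_n -> 'M[R]_n).
Variables (Omega : set 'cV[R]_n).

(** A maximum principle.  At an interior maximum other than 0 the gradient
    vanishes, so the trace is nonpositive and the differential inequality fails;
    hence every maximum point is 0.  A point other than 0 where Psi >= 1 = Psi 0
    would be another maximum point. *)
Lemma subsolution_lt1 :
    0 < lam -> compact Omega -> Omega 0 -> pd_on Omega q ->
    peval Psi 0 = 1 -> (forall x, Omega x -> 0 < peval Psi x) ->
    (forall x, Omega x -> ~ interior Omega x -> x != 0 -> peval Psi x < 1) ->
    (forall x, Omega x ->
       peval q x * peval Psi x / lam <=
       ((pgrad Psi x)^T *m mxeval f x) 0 0 + 2^-1 * \tr (phess Psi x *m S x)) ->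
    (forall x, Omega x -> x != 0 -> \tr (phess Psi x *m S x) <=
       ((pgrad Psi x)^T *m S x *m pgrad Psi x) 0 0 / peval Psi x) ->
  forall x, Omega x -> x != 0 -> peval Psi x < 1.
Proof.
move=> lam0 cO O0 [_ q_gt0] Psi0 Psi_gt0 bdry sub trace.
have max_eq0 y : Omega y -> (forall z, Omega z -> peval Psi z <= peval Psi y) ->
    y = 0.
  move=> Oy ymax; apply/eqP/negPn/negP => y0.
  have [iOy|niOy] := pselect (interior Omega y); last first.
    by have := bdry y Oy niOy y0; rewrite ltNge -Psi0 ymax.
  have := trace y Oy y0; have := sub y Oy.
  rewrite (pgrad_eq0_at_max iOy ymax) trmx0 !mul0mx !mxE add0r mul0r.
  have : 0 < peval q y * peval Psi y / lam.
    by rewrite divr_gt0// mulr_gt0 ?q_gt0 ?Psi_gt0.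
  by lra.
have [c] := @compact_EVT_max _ _ (peval Psi) _ (ex_intro _ 0 O0) cO
  (continuous_subspaceT (@peval_continuous _ _ Psi)).
rewrite inE => Oc cmax.
have c_max z : Omega z -> peval Psi z <= peval Psi c.
  by move=> Oz; apply: cmax; rewrite inE.
have c0 := max_eq0 c Oc c_max.
move=> x Ox; apply: contraNT; rewrite -leNgt => Psix.
apply/eqP/max_eq0 => // z Oz.
by rewrite (le_trans (c_max z Oz))// c0 Psi0.
Qed.

(** The factor lam of the logarithmic transform turns G R^-1 G^T into the noise
    covariance; what results is the drift of the Doob transform by Psi of the
    uncontrolled diffusion. *)
Lemma closed_loopE p (G : 'M[mpoly n R]_(n, p)) (Rm : 'M[R]_p) x :
    0 < peval Psi x ->
    S x = lam *: (mxeval G x *m invmx Rm *m (mxeval G x)^T) ->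
  closed_loop f G (feedback Rm G (Vupper lam Psi)) x =
    mxeval f x + (peval Psi x)^-1 *: (S x *m pgrad Psi x).
Proof.
move=> Psi_gt0 SE; rewrite /closed_loop /feedback grad_Vupper// SE.
congr (_ + _); rewrite mulmxN -!scalemxAr mulmxA -!scalemxAl scalerA.
by rewrite -scaleNr mulNr opprK mulmxA mulrC.
Qed.

(** The quadratic term enters the derivative along the closed loop with
    coefficient 1, and the trace costs at most one half of it. *)
Lemma subsolution_growth x :
    0 < peval Psi x ->
    0 <= ((pgrad Psi x)^T *m S x *m pgrad Psi x) 0 0 ->
    peval q x * peval Psi x / lam <=
      ((pgrad Psi x)^T *m mxeval f x) 0 0 + 2^-1 * \tr (phess Psi x *m S x) ->
    \tr (phess Psi x *m S x) <=
       ((pgrad Psi x)^T *m S x *m pgrad Psi x) 0 0 / peval Psi x ->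
  peval q x * peval Psi x / lam <=
    \sum_i peval (mderiv i Psi) x *
      (mxeval f x + (peval Psi x)^-1 *: (S x *m pgrad Psi x)) i 0.
Proof.
move=> Psi_gt0 S_ge0 sub trace.
have -> : \sum_i peval (mderiv i Psi) x *
      (mxeval f x + (peval Psi x)^-1 *: (S x *m pgrad Psi x)) i 0 =
    ((pgrad Psi x)^T *m mxeval f x) 0 0 +
    ((pgrad Psi x)^T *m S x *m pgrad Psi x) 0 0 / peval Psi x.
  transitivity (((pgrad Psi x)^T *m
      (mxeval f x + (peval Psi x)^-1 *: (S x *m pgrad Psi x))) 0 0).
    by rewrite [RHS]mxE; apply: eq_bigr => i _; rewrite [in RHS]mxE [in RHS]mxE.
  by rewrite mulmxDr -scalemxAr mulmxA mxE; congr (_ + _); rewrite mxE mulrC.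
have : 0 <= ((pgrad Psi x)^T *m S x *m pgrad Psi x) 0 0 / peval Psi x.
  by rewrite divr_ge0// ltW.
by lra.
Qed.

End LyapunovCertificate.

Theorem corollary5p5 (R : realType) (n p r k m d : nat)
  (* dynamics and cost *)
  (f : 'cV[mpoly n R]_n) (G : 'M[mpoly n R]_(n, p)) (Rm : 'M[R]_p)
  (phi q : mpoly n R)
  (* domain and its boundary *)
  (g : 'I_k -> mpoly n R) (h : 'I_m -> mpoly n R) (Omega : set 'cV[R]_n)
  (* stochastic auxiliary problem *)
  (lam : R) (B : 'M[mpoly n R]_(n, r)) (Seps : 'M[R]_r) (Sigma : 'M[mpoly n R]_n)
  (psi : mpoly n R) (Psi_star V_star : 'cV[R]_n -> R)
  (v : sos_vars R n k m)
  (Omega_def : Omega = semialg g)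
  (Omega_compact : compact Omega)
  (Omega0 : Omega 0)
  (* "∂Ω = {∏ h_i = 0}", whether or not the origin is counted on either side *)
  (boundary_def :
     bdry0 Omega = [set x | \prod_(i < m) peval (h i) x = 0] `|` [set 0])
  (f0 : mxeval f 0 = 0)
  (G0 : mxeval G 0 = 0)
  (Rm_pd : sym_posdef Rm)
  (phi_ge0 : forall x, 0 <= peval phi x)
  (q_ge0 : forall x, 0 <= peval q x)
  (phi_pd : pd_on Omega phi)
  (q_pd : pd_on Omega q)
  (lam_gt0 : 0 < lam)
  (B0 : mxeval B 0 = 0)
  (Seps_cov : covariance_mx Seps)
  (Sigma_def : Sigma = B *m mxconst n Seps *m B^T)
  (noise_control :
     mpolyC n lam *: (G *m mxconst n (invmx Rm) *m G^T) = Sigma)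
  (psi_bd : forall x, bdry0 Omega x -> peval psi x = expR (- peval phi x / lam))
  (Psi_star_sol : unique_nontrivial_viscosity_solution
     (Omega `\` bdry0 Omega) (bdry0 Omega)
     (linear_pde lam q f Sigma) (peval psi) Psi_star)
  (V_star_sol : unique_nontrivial_viscosity_solution
     (Omega `\` bdry0 Omega) (bdry0 Omega)
     (hjb_pde q f G Rm Sigma) (peval phi) V_star)
  (Psi_star_gt0 : forall x, Omega x -> 0 < Psi_star x)
  (V_star_def : forall x, Omega x -> V_star x = - lam * ln (Psi_star x))
  (v_sol : sos_solution d lam q psi f Sigma g h v)
  (Psi_l_gt0 : forall x, Omega x -> 0 < peval (Psi_l v) x) :
  let Vu := Vupper lam (Psi_l v) in
  let u_eps := feedback Rm G Vu in
  ((forall x, Omega x -> x != 0 ->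
      0 <= \tr (hess Vu x *m mxeval Sigma x)) ->
   stabilizing f G Omega u_eps /\
   (interior Omega 0 -> stabilizing f G setT u_eps))
  /\
  ((forall x, Omega x -> x != 0 ->
      0 < \tr (hess Vu x *m mxeval Sigma x)) ->
   asymp_stabilizing f G Omega u_eps /\
   (interior Omega 0 -> asymp_stabilizing f G setT u_eps)).
Proof.
move=> Vu u_eps; have [feas _] := v_sol.
set Psi := Psi_l v; set F := closed_loop f G u_eps.
have Psi0 : peval Psi 0 = 1 := con_origin feas.
have S_ge0 x (a : 'cV[R]_n) : 0 <= (a^T *m mxeval Sigma x *m a) 0 0.
  by rewrite Sigma_def; exact: noise_covariance_ge0.
have SE x : mxeval Sigma x =
    lam *: (mxeval G x *m invmx Rm *m (mxeval G x)^T).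
  by rewrite -noise_control mxevalZ !mxevalM mxeval_const mxeval_tr.
have F0 : F 0 = 0 by rewrite /F /closed_loop f0 G0 mul0mx addr0.
have FE x : Omega x ->
    F x = mxeval f x + (peval Psi x)^-1 *: (mxeval Sigma x *m pgrad Psi x).
  by move=> Ox; apply: closed_loopE; [exact: Psi_l_gt0|exact: SE].
have sub x : Omega x -> peval q x * peval Psi x / lam <=
    ((pgrad Psi x)^T *m mxeval f x) 0 0 +
    2^-1 * \tr (phess Psi x *m mxeval Sigma x).
  by rewrite Omega_def; exact: subsolution_on_semialg feas.
have bdry x : Omega x -> ~ interior Omega x -> x != 0 -> peval Psi x < 1.
  move=> Ox niOx x0.
  have bx : bdry0 Omega x by left; split=> //; exact: subset_closure.
  have hx : \prod_(i < m) peval (h i) x = 0.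
    by move: bx; rewrite boundary_def => -[//|/eqP]; rewrite (negPf x0).
  rewrite (le_lt_trans (subsolution_le_boundary_data feas hx))// psi_bd//.
  by rewrite expR_lt1 mulNr oppr_lt0 divr_gt0// (phi_pd.2 _ Ox x0).
pose w := mpolyC n 1 - Psi; pose r' := lam^-1 *: (q * Psi).
have r_pd : pd_on Omega r'.
  split=> [|x Ox x0]; rewrite pevalZ pevalM; first by rewrite q_pd.1 mul0r mulr0.
  by rewrite mulr_gt0 ?invr_gt0// mulr_gt0 ?(q_pd.2 _ Ox)// Psi_l_gt0.
have lyapunov : (forall x, Omega x -> x != 0 ->
      0 <= \tr (hess Vu x *m mxeval Sigma x)) ->
    pd_on Omega w /\ lyapunov_decay Omega F w r'.
  move=> trV.
  have trPsi x : Omega x -> x != 0 -> \tr (phess Psi x *m mxeval Sigma x) <=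
      ((pgrad Psi x)^T *m mxeval Sigma x *m pgrad Psi x) 0 0 / peval Psi x.
    move=> Ox x0; rewrite -(trace_hess_Vupper _ lam_gt0) ?Psi_l_gt0//.
    exact: trV.
  split.
    split=> [|x Ox x0]; rewrite pevalD pevalN pevalC ?Psi0 ?subrr// subr_gt0.
    exact: (subsolution_lt1 lam_gt0 Omega_compact Omega0 q_pd Psi0 Psi_l_gt0
      bdry sub trPsi).
  move=> x Ox.
  have -> : \sum_i peval (mderiv i w) x * F x i 0 =
      - \sum_i peval (mderiv i Psi) x * F x i 0.
    rewrite -sumrN; apply: eq_bigr => i _.
    by rewrite mderivB mderivC sub0r pevalN mulNr.
  (* the trace hypothesis is only available off the origin; at 0 both sides
     vanish, since q 0 = 0 and F 0 = 0 *)
  rewrite lerN2 pevalZ pevalM mulrC; have [->|x0] := eqVneq x 0.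
    rewrite q_pd.1 !mul0r big1// => i _; by rewrite F0 mxE mulr0.
  rewrite FE//; apply: subsolution_growth => //; last exact: trPsi.
    exact: Psi_l_gt0.
  exact: sub.
have asymp : (forall x, Omega x -> x != 0 ->
      0 <= \tr (hess Vu x *m mxeval Sigma x)) -> asymp_stable_eq Omega F.
  move=> /lyapunov[w_pd w_decay]; split.
    exact: lyapunov_stable Omega_compact F0 w_pd r_pd w_decay.
  exists 1 => // x xtraj _.
  exact: lyapunov_attractive Omega_compact w_pd r_pd w_decay xtraj.
split=> [/asymp[stab _]|trV].
  by split=> // O0; exact: (stable_eq_setT O0 stab).
have stab : asymp_stable_eq Omega F.
  by apply: asymp => x Ox x0; exact/ltW/trV.
by split=> // O0; exact: (asymp_stable_eq_setT O0 stab).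
Qed.
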